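(* Let $\mathcal{S}$ be a given (finite) stratification of $\mathfrak{U}=[0,1]^n$. Suppose that for every stratum $S\in\mathcal{S}$ there exists a finite constant $M_S\ge 0$ such that the empirical standard deviation satisfies $\hat\sigma_S\le M_S$ almost surely. (i) The variance estimator for proportional sample allocation satisfies $$\mathbb{P}\Bigl(\bigl\vert \hat{V}_{\mathrm{prop}} - V_{\mathrm{prop}} \bigr\vert \ge \vartheta \Bigr) \le 2 \exp\left(- \frac{2 \vartheta^2 N^2}{\sum_{S\in\mathcal{S}} p_S^2 M_S^4}\right)$$ for any $\vartheta>0$. (ii) The variance estimator for optimal sample allocation satisfies $$\mathbb{P}\Bigl(\bigl\vert \hat{V}_{\mathrm{opt}} - V_{\mathrm{opt}} \bigr\vert \ge \vartheta \Bigr) \le 2 \exp\left(-\frac{2\left(\lvert B\rvert - \vartheta N\right)^2}{\left(\sum_{S\in\mathcal{S}} p_S M_S\right)^4}\right)$$ for any $\vartheta >\frac{\lvert B\rvert}{N}$, where $B := \sum_{S,T\in\mathcal{S},\, S\neq T}p_S p_T \bigl(b_S b_T + b_S \sigma_T + b_T \sigma_S\bigr)$ with $b_S := \mathbb{E}(\hat\sigma_S) - \sigma_S$ for $S\in\mathcal{S}$.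
   Context: Let $\mathbf{Y}$ be uniformly distributed on $\mathfrak{U}=[0,1]^n$, let $f\colon\mathbb{R}^n\to\mathbb{R}$ be measurable and $Q=f(\mathbf{Y})\in L^2(\Omega,\mathcal{F},\mathbb{P})$. A stratification $\mathcal{S}$ of $\mathfrak{U}$ is a finite collection of pairwise disjoint measurable sets (strata) with union $\mathfrak{U}$. For $S\in\mathcal{S}$ let $p_S=\mathbb{P}(\mathbf{Y}\in S)$ (assumed positive), let $Q_S$ be a random variable having the conditional distribution of $f(\mathbf{Y})$ given $\mathbf{Y}\in S$, and let $\sigma_S^2=\mathrm{Var}(Q_S)$, $\sigma_S\ge 0$. Given a total number of samples $N=\sum_{S\in\mathcal{S}}N_S$, in each stratum $S$ one draws $N_S$ i.i.d. samples $Q_S^{(1)},\dots,Q_S^{(N_S)}$ of $Q_S$; samples in different strata are independent. The empirical variance is $$\hat\sigma_S^2=\frac{1}{N_S-1}\sum_{j=1}^{N_S}\bigl(Q_S^{(j)}-\overline{Q}_S\bigr)^2,\qquad \overline{Q}_S=\frac1{N_S}\sum_{j=1}^{N_S}Q_S^{(j)},$$ and $\hat\sigma_S=\sqrt{\hat\sigma_S^2}$ is the empirical standard deviation. Proportional allocation means $N_S=p_SN$ and optimal allocation means $N_S=\frac{p_S\sigma_S}{\sum_{T\in\mathcal{S}}p_T\sigma_T}N$; in each case these numbers are taken to be integers, at least $2$, so that $\hat\sigma_S^2$ is defined. The variances of the corresponding stratified sampling estimators and their natural estimators are $$V_{\mathrm{prop}}=\frac1N\sum_{S\in\mathcal{S}}p_S\sigma_S^2,\qquad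 V_{\mathrm{opt}}=\frac1N\Bigl(\sum_{S\in\mathcal{S}}p_S\sigma_S\Bigr)^2,$$ $$\hat V_{\mathrm{prop}}=\frac1N\sum_{S\in\mathcal{S}}p_S\hat\sigma_S^2,\qquad \hat V_{\mathrm{opt}}=\frac1N\Bigl(\sum_{S\in\mathcal{S}}p_S\hat\sigma_S\Bigr)^2.$$ In (i) the $\hat\sigma_S$ are computed with the proportional sample sizes, in (ii) with the optimal sample sizes. If the denominator in an exponent is zero, the exponential is read as $0$. *)

(* Defs.v *)
From HB Require Import structures.
From mathcomp Require Export all_boot all_order all_algebra.
From mathcomp Require Export all_classical all_reals all_analysis.
Set Implicit Arguments.
Unset Strict Implicit.
Unset Printing Implicit Defensive.
Import Order.TTheory GRing.Theory Num.Theory.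
Import numFieldNormedType.Exports.

Local Open Scope classical_set_scope.
Local Open Scope ring_scope.

(* R^n is [n.-tuple R] with the product sigma-algebra. *)
Section cube.
Context {R : realType}.

Definition unit_cube (n : nat) : set (n.-tuple R) :=
  [set y | forall i, 0 <= tnth y i <= 1].
Arguments unit_cube n : clear implicits.

(* n-dimensional Lebesgue measure, as an iterated integral over the first
   coordinate (the library has no n-fold product measure on tuples). *)
Fixpoint lebesgue_tuple (n : nat) : set (n.-tuple R) -> \bar R :=
  match n with
  | 0 => fun A => \d_([tuple]) A
  | k.+1 => fun A =>
      (\int[lebesgue_measure]_x lebesgue_tuple [set t | A (cons_tuple x t)])%E
  end.

Definition is_stratification (n : nat) (I : finType)
    (S : I -> set (n.-tuple R)) : Prop :=
  [/\ forall s, measurable (S s),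
      trivIset setT S &
      \bigcup_s S s = unit_cube n].

End cube.
Arguments unit_cube R n : clear implicits.

Section probability.
Local Open Scope ereal_scope.
Context {d : measure_display} {T : measurableType d} {R : realType}.
Implicit Type P : probability T R.

(* The normalising constant, the Lebesgue measure of the unit cube, is 1. *)
Definition uniform_on_cube P (n : nat) (Y : {RV P >-> n.-tuple R}) : Prop :=
  forall A, measurable A ->
    distribution P Y A = lebesgue_tuple (A `&` unit_cube R n).

Definition has_cond_distribution P (X : {RV P >-> R}) (g : T -> R)
    (E : set T) : Prop :=
  forall A, measurable A ->
    distribution P X A = P (g @^-1` A `&` E) / P E.

Definition same_distribution P (X X' : {RV P >-> R}) : Prop :=
  forall A, measurable A -> distribution P X A = distribution P X' A.

Definition mutually_independent P (K : finType) (X : K -> {RV P >-> R}) : Prop :=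
  forall (J : {set K}) (A : K -> set R), (forall k, measurable (A k)) ->
    P (\bigcap_(k in [set` J]) (X k @^-1` A k)) =
    \prod_(k in J) P (X k @^-1` A k).

Definition std_dev P (X : T -> R) : R := Num.sqrt (fine 'V_P[X]).

End probability.

Section estimators.
Context {R : realType}.

Definition emp_mean {T : Type} (m : nat) (X : 'I_m -> T -> R) (w : T) : R :=
  m%:R^-1 * \sum_j X j w.

Definition emp_var {T : Type} (m : nat) (X : 'I_m -> T -> R) (w : T) : R :=
  (m%:R - 1)^-1 * \sum_j (X j w - emp_mean X w) ^+ 2.

Definition emp_std_dev {T : Type} (m : nat) (X : 'I_m -> T -> R) (w : T) : R :=
  Num.sqrt (emp_var X w).

Context {I : finType}.
Implicit Types p sigma b : I -> R.

Definition proportional_allocation (N : nat) p (m : I -> nat) : Prop :=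
  forall s, (m s)%:R = p s * N%:R.

Definition optimal_allocation (N : nat) p sigma (m : I -> nat) : Prop :=
  forall s, (m s)%:R = p s * sigma s / (\sum_t p t * sigma t) * N%:R.

(* [var_prop] and [var_opt] give the variance of the stratified estimator when
   [sigma] holds the true standard deviations of the strata, and its empirical
   estimator when [sigma] holds the empirical ones. *)
Definition var_prop (N : nat) p sigma : R :=
  N%:R^-1 * \sum_s p s * sigma s ^+ 2.

Definition var_opt (N : nat) p sigma : R :=
  N%:R^-1 * (\sum_s p s * sigma s) ^+ 2.

Definition bias_opt p sigma b : R :=
  \sum_s \sum_(t | t != s)
    p s * p t * (b s * b t + b s * sigma t + b t * sigma s).

(* exp (- a / c), read as 0 when c = 0. *)
Definition exp_neg_div (a c : R) : R := if c == 0 then 0 else expR (- (a / c)).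

End estimators.

(* Main.v *)
Require Import Defs.
From HB Require Import structures.
From mathcomp Require Import ring lra measurable_realfun.
Set Implicit Arguments.
Unset Strict Implicit.
Unset Printing Implicit Defensive.
Import Order.TTheory GRing.Theory Num.Theory.
Import numFieldNormedType.Exports.
Local Open Scope classical_set_scope.
Local Open Scope ring_scope.

(** Both tail bounds come from Hoeffding's lemma: a variable with values in an
    interval of length [c] satisfies [E exp (l (W - E W)) <= exp (l^2 c^2 / 8)]
    ([ae_bounded_subgaussian]). By convexity of the exponential it suffices to
    treat Bernoulli variables ([expR_le_chord]), for which the logarithm of the
    moment generating function has second derivative at most 1/4
    ([bernoulli_mgf_le]). Such a bound on the moment generating function gives
    the tail [2 exp (- 2 t^2 / c^2)] by Chernoff's method ([subgaussian_tail]).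

    For proportional allocation, [N] times the estimator is the sum over the
    strata of [p s * sigma_hat s ^+ 2]. These terms are independent, have values
    in [[0, p s * M s ^+ 2]], and are unbiased since the empirical variance is
    ([expectation_emp_var]). The squared lengths of the intervals add up
    ([subgaussian_sum_blocks]), which gives (i).

    For optimal allocation, [N] times the estimator is [W], the square of
    [\sum_s p s * sigma_hat s]. Expanding the square and using independence
    between strata, its mean is [(\sum_s p s * sigma s) ^+ 2 + B]
    ([expectation_sqr_sum_sigma_hat]). As one single variable with values in
    [[0, (\sum_s p s * M s) ^+ 2]], it satisfies Hoeffding's tail bound around
    its mean, and a deviation [theta * N] from [(\sum_s p s * sigma s) ^+ 2]
    forces a deviation [theta * N - `|B|] from the mean. This gives (ii).

    Independence between functions of disjoint sets of samples is obtained from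
    the pi-lambda theorem ([disjoint_sigma_independent]), and
    square-integrability of the samples of a stratum from that of [f \o Y],
    whose law dominates the conditional one up to a factor
    ([cond_distribution_Lfun1]). *)

(** * Hoeffding's bound for the Bernoulli moment generating function *)

Section mgf_bound.
Context {R : realType}.
Implicit Types p h x : R.

Let D p h := 1 - p + p * expR h.
Let D_gt0 p h : 0 <= p <= 1 -> 0 < D p h.
Proof.
move=> /andP[p0 p1]; rewrite /D; have e0 := expR_gt0 h.
have [->|pn0] := eqVneq p 0; first by rewrite subr0 mul0r addr0.
have : 0 < p * expR h by rewrite mulr_gt0// lt_neqAle eq_sym pn0.
by move: p1; lra.
Qed.

(* [gap p] is the difference of the logarithms of the two sides of the bound,
   and [gap' p] its derivative. [tilted p h] is the success probability after
   exponential tilting by [h]; the second derivative of [ln (D p)] at [h] is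
   the variance [tilted p h * (1 - tilted p h)], which is at most 1/4. *)
Let tilted p h := p * expR h / D p h.
Let gap p h := p * h + h ^+ 2 / 8 - ln (D p h).
Let gap' p h := p + h / 4 - tilted p h.

Let is_derive_D p h : is_derive h 1 (D p) (p * expR h).
Proof.
have -> : D p = cst (1 - p) + p *: expR by apply/funext => x.
by apply: is_derive_eq; rewrite add0r.
Qed.

Let is_derive_gap p h : 0 <= p <= 1 -> is_derive h 1 (gap p) (gap' p h).
Proof.
move=> p01; have D0 := D_gt0 h p01.
have dD := is_derive_D p h.
have dln : is_derive (D p h) 1 (@ln R) (D p h)^-1 by exact: is_derive1_ln.
have dc : is_derive h 1 (@ln R \o D p) ((D p h)^-1 * (p * expR h)).
  exact: is_derive1_comp.
have -> : gap p = p *: id + 8^-1 *: (id ^+ 2) - (@ln R \o D p).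
  by apply/funext => x; rewrite /gap !fctE /GRing.scale/= [8^-1 * _]mulrC.
apply: is_derive_eq.
rewrite /gap' /tilted /GRing.scale/=.
by field; rewrite gt_eqF.
Qed.

Let is_derive_gap' p h : 0 <= p <= 1 ->
  is_derive h 1 (gap' p) (4^-1 - tilted p h * (1 - tilted p h)).
Proof.
move=> p01; have D0 := D_gt0 h p01.
have dD := is_derive_D p h.
have dV : is_derive h 1 (fun x => (D p x)^-1) (- (D p h) ^- 2 *: (p * expR h)).
  by apply: is_deriveV; rewrite gt_eqF.
have -> : gap' p = cst p + 4^-1 *: id - (p *: expR) * (fun x => (D p x)^-1).
  apply/funext => x.
  by rewrite /gap' /tilted !fctE /GRing.scale/= [4^-1 * _]mulrC.
apply: is_derive_eq.
rewrite /tilted /= /GRing.scale/= -[_ *: expR h]/(p * expR h).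
by field; rewrite gt_eqF.
Qed.

Let gap'_ge0 p h : 0 <= p <= 1 -> 0 <= h -> 0 <= gap' p h.
Proof.
move=> p01 h0.
have -> : 0 = gap' p 0.
  by rewrite /gap' /tilted /D expR0 mul0r addr0 mulr1 subrK divr1 subrr.
have der x := is_derive_gap' x p01.
apply: (@ger0_derive1_ndecry _ (gap' p) 0) => //.
- move=> x _; rewrite derive1E derive_val.
  have := sqr_ge0 (tilted p x - 2^-1); rewrite sqrrB; lra.
- apply: derivable_within_continuous => x _; exact: ex_derive.
Qed.

Let gap_ge0 p h : 0 <= p <= 1 -> 0 <= h -> 0 <= gap p h.
Proof.
move=> p01 h0.
have -> : 0 = gap p 0.
  by rewrite /gap /D expR0 mulr1 subrK ln1 mulr0 expr0n/= mul0r !addr0 subrr.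
have der x := is_derive_gap x p01.
apply: (@ger0_derive1_ndecry _ (gap p) 0) => //.
- move=> x; rewrite in_itv/= andbT => /ltW x0.
  by rewrite derive1E derive_val gap'_ge0.
- apply: derivable_within_continuous => x _; exact: ex_derive.
Qed.

Let bernoulli_mgf_ge0 p h : 0 <= p <= 1 -> 0 <= h ->
  1 - p + p * expR h <= expR (p * h + h ^+ 2 / 8).
Proof.
move=> p01 h0; have := gap_ge0 p01 h0; have D0 := D_gt0 h p01.
by rewrite /gap subr_ge0 -[X in _ -> X <= _]lnK ?posrE// ler_expR.
Qed.

(** A negative [h] reduces to a positive one by exchanging success and
    failure. *)
Lemma bernoulli_mgf_le p h : 0 <= p <= 1 ->
  1 - p + p * expR h <= expR (p * h + h ^+ 2 / 8).
Proof.
move=> p01; have [h0|/ltW h0] := leP 0 h; first exact: bernoulli_mgf_ge0.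
have q01 : 0 <= 1 - p <= 1 by move: p01; lra.
have k0 : 0 <= - h by rewrite oppr_ge0.
have := bernoulli_mgf_ge0 q01 k0.
rewrite -(ler_pM2l (expR_gt0 h)) -expRD sqrrN.
have -> : expR h * (1 - (1 - p) + (1 - p) * expR (- h)) = 1 - p + p * expR h.
  rewrite expRN; field; exact: lt0r_neq0 (expR_gt0 h).
by congr (_ <= expR _); ring.
Qed.

(** Convexity reduces every variable with values in [[0, c]] to the Bernoulli
    variable on [{0, c}] that has the same mean. *)
Lemma expR_le_chord (c z l : R) : 0 < c -> 0 <= z <= c ->
  expR (l * z) <= 1 - z / c + z / c * expR (l * c).
Proof.
move=> c0 /andP[z0 zc].
have t0 : 0 <= z / c by rewrite divr_ge0// ltW.
have t1 : z / c <= 1 by rewrite ler_pdivrMr// mul1r.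
have := convex_expR (Itv01 t0 t1) (l * c) 0.
rewrite !convRE/= expR0 !mulr1 mulr0 addr0 [X in _ <= X]addrC.
by rewrite mulrCA divfK ?gt_eqF.
Qed.
End mgf_bound.

(** * Independence of functions of disjoint subfamilies *)

Section independence.
Context {d : measure_display} {T : measurableType d} {R : realType}.
Variable P : probability T R.

(** The events independent of a fixed event form a Dynkin system, so that
    independence passes from a pi-system to the sigma-algebra it generates. *)
Lemma pi_lambda_independent (G : set (set T)) (E : set T) :
    setI_closed G -> G `<=` measurable -> measurable E ->
    (forall F, G F -> P (F `&` E) = (P F * P E)%E) ->
  forall F, <<s G>> F -> measurable F /\ P (F `&` E) = (P F * P E)%E.
Proof.
move=> GI Gm mE GE.
pose H := [set F | measurable F /\ P (F `&` E) = (P F * P E)%E].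
suff : <<s G>> `<=` H by [].
apply: lambda_system_subset => //; last first.
  by move=> F GF; split; [exact: Gm|exact: GE].
apply/dynkin_lambda_system; split.
- by split=> //; rewrite setTI probability_setT mul1e.
- move=> A [mA PA]; split; first exact: measurableC.
  have -> : ~` A `&` E = E `\` (A `&` E).
    by rewrite setDE setCI setIUr setICr setU0 setIC.
  rewrite measureD//; last 2 first.
  + exact: measurableI.
  + by rewrite (le_lt_trans (probability_le1 P mE))// ltry.
  have -> : E `&` (A `&` E) = A `&` E by rewrite setIC -setIA setIid.
  rewrite [X in (_ - X)%E]PA probability_setC//.
  rewrite -[LHS]/(P E - P A * P E)%E.
  rewrite -(fineK (fin_num_measure P _ mA)) -(fineK (fin_num_measure P _ mE)).
  by rewrite -EFinM -!EFinB -EFinM mulrBl mul1r.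
- move=> F tF HF; have mF n : measurable (F n) by case: (HF n).
  split; first exact: bigcup_measurable.
  rewrite setI_bigcupl.
  have mFE n : measurable (F n `&` E) by exact: measurableI.
  have tFE : trivIset setT (fun n => F n `&` E).
    apply/trivIsetP => i j _ _ ij; rewrite setIACA.
    by move/trivIsetP : tF => -> //; rewrite set0I.
  rewrite !measure_bigcup//.
  have PE := fineK (fin_num_measure P _ mE).
  rewrite (eq_eseriesr (g := fun n => ((fine (P E))%:E * P (F n))%E));
    last by move=> n _; rewrite PE muleC; case: (HF n).
  rewrite nneseriesZl ?PE; first by rewrite muleC.
  by move=> n _; exact: measure_ge0.
Qed.

Context {K : finType} (X : K -> {RV P >-> R}).
Implicit Type J : {set K}.

(** A pi-system that generates the sigma-algebra of the family
    [(X k)], [k \in J]. *)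
Definition cylinders J : set (set T) :=
  [set (\bigcap_(k in [set` J]) (X k @^-1` A k)) | A in
    [set A : K -> set R | forall k, measurable (A k)]].

Lemma measurable_preimage (f : {RV P >-> R}) (A : set R) :
  measurable A -> measurable (f @^-1` A).
Proof. by move=> mA; rewrite -[_ @^-1` _]setTI; exact: measurable_funP. Qed.

Lemma cylinders_measurable J : cylinders J `<=` measurable.
Proof.
move=> _ [A mA <-]; apply: fin_bigcap_measurable => //= k _.
exact: measurable_preimage.
Qed.

Lemma setI_closed_cylinders J : setI_closed (cylinders J).
Proof.
move=> _ _ [A mA <-] [B mB <-]; exists (fun k => A k `&` B k).
  by move=> k; exact: measurableI.
by rewrite -bigcapI; apply: eq_bigcapr.
Qed.

(** [T] with the sigma-algebra of the family [(X k)], [k \in J]. With it,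
    being a function of this family is measurability of a map from
    [sigma_gen J], to which the usual closure properties apply. *)
Definition sigma_gen J := g_sigma_algebraType (cylinders J).

Lemma sigma_gen_measurable J (A : set T) : <<s cylinders J>> A -> measurable A.
Proof.
apply: smallest_sub; last exact: cylinders_measurable.
exact: sigma_algebra_measurable.
Qed.

Lemma measurable_sigma_gen J k : k \in J ->
  measurable_fun [set: sigma_gen J] (X k : sigma_gen J -> R).
Proof.
move=> kJ _ A mA; rewrite setTI; apply: sub_sigma_algebra.
(* the cylinder that constrains the single coordinate k *)
exists (fun i => if i == k then A else setT).
  by move=> i; case: ifP.
apply/seteqP; split => [w /(_ k)|w Aw i /= iJ].
  by rewrite /= eqxx; apply.
by case: eqP => // ->.
Qed.

Lemma sigma_gen_measurable_fun J (U : T -> R) :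
  measurable_fun [set: sigma_gen J] (U : sigma_gen J -> R) ->
  measurable_fun [set: T] U.
Proof.
move=> mU _ A mA; apply: (@sigma_gen_measurable J).
exact: (mU measurableT A mA).
Qed.

Hypothesis indX : mutually_independent X.

Lemma disjoint_cylinders_independent J1 J2 (E F : set T) :
  {in J1, forall k, k \notin J2} ->
  cylinders J1 E -> cylinders J2 F -> P (E `&` F) = (P E * P F)%E.
Proof.
move=> dJ [A mA <-] [B mB <-].
rewrite !indX//.
have kJ1 k : k \in J2 -> k \notin J1 by apply: contraL; exact: dJ.
pose C k := if k \in J1 then A k else B k.
have mC k : measurable (C k) by rewrite /C; case: ifP.
transitivity (P (\bigcap_(k in [set` J1 :|: J2]) (X k @^-1` C k))).
  congr (P _); apply/seteqP; split => [w [wA wB] k /=|w wC].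
    rewrite inE /C; case: ifPn => [kJ _|kJ /= kJ2]; first exact: wA.
    exact: wB.
  split=> k /= kJ.
    by have /= := wC k; rewrite inE kJ /C kJ; exact.
  have /= := wC k; rewrite inE kJ orbT /C.
  by rewrite (negbTE (kJ1 _ kJ)); exact.
rewrite indX//.
have e : (J1 :|: J2) =i [predU J1 & J2] by move=> k; rewrite !inE.
rewrite (eq_bigl _ _ e) bigU/=; last first.
  by apply/pred0P => k /=; apply/negP => /andP[/dJ/negbTE->].
congr (_ * _)%E; apply: eq_bigr => k kJ.
  by rewrite /C kJ.
by rewrite /C (negbTE (kJ1 _ kJ)).
Qed.

(** The pi-system argument is used twice, once for each of the two
    sigma-algebras. *)
Lemma disjoint_sigma_independent J1 J2 (E F : set T) :
  {in J1, forall k, k \notin J2} ->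
  <<s cylinders J1>> E -> <<s cylinders J2>> F -> P (E `&` F) = (P E * P F)%E.
Proof.
move=> dJ sE sF; rewrite setIC muleC.
apply: (proj2 (pi_lambda_independent (@setI_closed_cylinders J2)
  (@cylinders_measurable J2) _ _ sF)); first exact: sigma_gen_measurable sE.
move=> {sF}F cF; rewrite setIC muleC.
apply: (proj2 (pi_lambda_independent (@setI_closed_cylinders J1)
  (@cylinders_measurable J1) _ _ sE)); first exact: cylinders_measurable cF.
by move=> {sE}E cE; exact: (disjoint_cylinders_independent dJ).
Qed.

End independence.

(** * Expectation of a product of independent variables *)

Section expectation_prod.
Local Open Scope ereal_scope.
Context {d : measure_display} {T : measurableType d} {R : realType}.
Variable P : probability T R.

Definition independent2 (U V : T -> R) :=
  forall A B, measurable A -> measurable B ->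
    P ((U @^-1` A) `&` (V @^-1` B)) = P (U @^-1` A) * P (V @^-1` B).

Definition pair_rv (U V : {RV P >-> R}) (w : T) := (U w, V w).

Lemma measurable_pair_rv (U V : {RV P >-> R}) :
  measurable_fun setT (pair_rv U V).
Proof. exact: measurable_fun_pair. Qed.

HB.instance Definition _ (U V : {RV P >-> R}) :=
  isMeasurableFun.Build _ _ _ _ (pair_rv U V) (measurable_pair_rv U V).

(** Both sides agree on rectangles; this gives the product rules below by
    Tonelli and Fubini. *)
Lemma distribution_pair (U V : {RV P >-> R}) B :
  independent2 U V -> measurable B ->
  distribution P (pair_rv U V) B = (distribution P U \x distribution P V) B.
Proof.
by move=> UV mB; exact/esym/product_measure_unique.
Qed.

Lemma ge0_integral_prod_independent (U V : {RV P >-> R}) (f g : R -> R) :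
  independent2 U V -> measurable_fun setT f -> measurable_fun setT g ->
  (forall x, (0 <= f x)%R) -> (forall x, (0 <= g x)%R) ->
  \int[P]_w (f (U w) * g (V w))%:E =
    \int[P]_w (f (U w))%:E * \int[P]_w (g (V w))%:E.
Proof.
move=> UV mf mg f0 g0.
pose h (z : R * R) := (f z.1 * g z.2)%:E.
have h0 z : 0 <= h z by rewrite lee_fin mulr_ge0.
have mh : measurable_fun setT h.
  apply/measurable_EFinP; apply: measurable_funM.
    exact: measurableT_comp mf measurable_fst.
  exact: measurableT_comp mg measurable_snd.
have Ef0 x : 0 <= (f x)%:E by rewrite lee_fin.
have Eg0 x : 0 <= (g x)%:E by rewrite lee_fin.
have mEf : measurable_fun setT (fun x => (f x)%:E) by exact/measurable_EFinP.
have mEg : measurable_fun setT (fun x => (g x)%:E) by exact/measurable_EFinP.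
transitivity (\int[distribution P (pair_rv U V)]_z h z).
  by rewrite ge0_integral_distribution.
rewrite (eq_measure_integral (distribution P U \x distribution P V)%E);
  last by move=> A mA _; exact: distribution_pair.
rewrite fubini_tonelli1//.
transitivity (\int[distribution P U]_x
    ((f x)%:E * \int[distribution P V]_y (g y)%:E)).
  by apply: eq_integral => x _; rewrite /fubini_F /h/= -ge0_integralZl.
by rewrite ge0_integralZr// ?integral_ge0// !ge0_integral_distribution.
Qed.

Lemma Lfun1_prod_independent (U V : {RV P >-> R}) :
  independent2 U V -> (U : T -> R) \in Lfun P 1 -> (V : T -> R) \in Lfun P 1 ->
  (U \* V)%R \in Lfun P 1.
Proof.
move=> UV /Lfun1_integrable/integrableP[mU iU].
move=> /Lfun1_integrable/integrableP[mV iV].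
apply/Lfun1_integrable/integrableP; split.
  by apply/measurable_EFinP; exact: measurable_funM.
under eq_integral do rewrite /= normrM.
rewrite (ge0_integral_prod_independent (f := Num.norm) (g := Num.norm))//.
have i0 (f : T -> R) : 0 <= \int[P]_w `|f w|%:E.
  by apply: integral_ge0 => w _; rewrite lee_fin.
by apply: lte_mul_pinfty => //; rewrite ge0_fin_numE.
Qed.

Lemma integrable_distribution_id (U : {RV P >-> R}) :
  P.-integrable setT (EFin \o U) ->
  (distribution P U).-integrable setT (EFin : R -> \bar R).
Proof.
by move=> iU; exact: integrable_pushforward.
Qed.

Lemma expectation_prod_independent (U V : {RV P >-> R}) :
  independent2 U V -> (U : T -> R) \in Lfun P 1 -> (V : T -> R) \in Lfun P 1 ->
  'E_P[U \* V] = 'E_P[U] * 'E_P[V].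
Proof.
move=> UV U1 V1.
have /Lfun1_integrable iUV := Lfun1_prod_independent UV U1 V1.
move: U1 V1 => /Lfun1_integrable iU /Lfun1_integrable iV.
pose h (z : R * R) := (z.1 * z.2)%:E.
have mh : measurable_fun setT h.
  by apply/measurable_EFinP; apply: measurable_funM.
pose pr := (distribution P U \x distribution P V)%E.
have pairE (k : R * R -> \bar R) :
    \int[pr]_z k z = \int[distribution P (pair_rv U V)]_z k z.
  by apply: eq_measure_integral => A mA _; exact/esym/distribution_pair.
have ih : pr.-integrable setT h.
  apply/integrableP; split=> //; rewrite pairE ge0_integral_distribution//.
    by case/integrableP : iUV.
  exact: measurableT_comp.
rewrite unlock -(integral_distribution (X := pair_rv U V) (f := h))// -pairE.
rewrite -integral12_prod_meas1//.
have mE : measurable_fun setT (EFin : R -> \bar R) by exact: EFin_measurable.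
transitivity (\int[distribution P U]_x (x%:E * \int[distribution P V]_y y%:E)).
  apply: eq_integral => x _; rewrite /fubini_F /h/= -integralZl//.
  exact: integrable_distribution_id.
have /= -> := integral_distribution (X := V) (f := EFin) mE iV.
rewrite -(fineK (integrable_fin_num _ iV))// integralZr//; last first.
  exact: integrable_distribution_id.
by have /= -> := integral_distribution (X := U) (f := EFin) mE iU.
Qed.
End expectation_prod.

(** * Subgaussian tails and Hoeffding's lemma *)

Lemma measurable_set_ge {d} {T : measurableType d} {R : realType} (f : T -> R)
  (t : R) : measurable_fun setT f -> measurable [set w | t <= f w].
Proof.
move=> mf; have -> : [set w | t <= f w] = f @^-1` `[t, +oo[%classic.
  by apply/seteqP; split => w; rewrite /= in_itv/= andbT.
by rewrite -[_ @^-1` _]setTI; apply: mf.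
Qed.

Section subgaussian.
Local Open Scope ereal_scope.
Context {d : measure_display} {T : measurableType d} {R : realType}.
Variable P : probability T R.

(** The usual variance proxy is [v / 4]. Under this normalisation, [v] is
    [c ^+ 2] for a centred variable with values in an interval of length
    [c]. *)
Definition subgaussian (W : T -> R) (v : R) :=
  forall l : R, \int[P]_w (expR (l * W w))%:E <= (expR (l ^+ 2 * v / 8))%:E.

Lemma subgaussianN (W : T -> R) v : subgaussian W v -> subgaussian (\- W)%R v.
Proof.
move=> sW l; rewrite -sqrrN.
by under eq_integral do rewrite mulrN -mulNr; exact: sW.
Qed.

Lemma subgaussianD_independent (U V : {RV P >-> R}) u v :
  independent2 P U V -> subgaussian U u -> subgaussian V v ->
  subgaussian (U \+ V)%R (u + v).
Proof.
move=> UV sU sV l.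
have me : measurable_fun setT (fun x : R => expR (l * x)).
  by apply: measurableT_comp => //; exact: mulrl_measurable.
under eq_integral do rewrite mulrDr expRD.
rewrite (ge0_integral_prod_independent (f := fun x => expR (l * x))
  (g := fun x => expR (l * x)) UV); last 4 first.
- exact: me.
- exact: me.
- by move=> x; exact: expR_ge0.
- by move=> x; exact: expR_ge0.
rewrite mulrDr mulrDl expRD EFinM; apply: lee_pmul; last 2 first.
- exact: sU.
- exact: sV.
- by apply: integral_ge0 => w _; rewrite lee_fin expR_ge0.
- by apply: integral_ge0 => w _; rewrite lee_fin expR_ge0.
Qed.

(** Chernoff's bound at the optimal exponent [4 * t / v]. For [v = 0] every
    exponent is allowed, and letting it grow gives probability 0. *)
Lemma subgaussian_upper_tail (W : {RV P >-> R}) v t : (0 <= v)%R -> (0 < t)%R ->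
  subgaussian W v ->
  P [set w | (t <= W w)%R] <= (exp_neg_div (2 * t ^+ 2) v)%:E.
Proof.
move=> v0 t0 sW.
have mP : measurable [set w | (t <= W w)%R] by exact: measurable_set_ge.
have chern r : (0 < r)%R ->
    P [set w | (t <= W w)%R] <= (expR (r ^+ 2 * v / 8 - r * t))%:E.
  move=> r0; apply: (le_trans (chernoff W t r0)).
  rewrite expRD EFinM lee_wpmul2r ?lee_fin ?expR_ge0// /mmt_gen_fun unlock.
  apply: le_trans (sW r); apply: ge0_le_integral => //=.
  - apply/measurable_EFinP; apply: measurableT_comp => //.
    exact: measurable_funM.
  - apply/measurable_EFinP; apply: measurableT_comp => //.
    exact: measurable_funM.
  - by move=> w _; rewrite mulrC.
rewrite /exp_neg_div; case: eqP => [vE|/eqP vn0].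
  rewrite -(fineK (fin_num_measure P _ mP)) lee_fin leNgt; apply/negP => q0.
  set q := fine _ in q0.
  (* an exponent r with expR (r * t) > q^-1, by expR x >= 1 + x *)
  have q1 : (0 < (1 + q^-1) / t)%R by rewrite divr_gt0// addr_gt0// invr_gt0.
  have := chern _ q1; rewrite -(fineK (fin_num_measure P _ mP)) lee_fin -/q.
  rewrite vE mulr0 mul0r sub0r divfK ?gt_eqF// expRN.
  apply/negP; rewrite -ltNge invf_plt ?posrE ?expR_gt0//.
  apply: lt_le_trans (expR_ge1Dx _).
  by rewrite addrA ltrDr.
have vp : (0 < v)%R by rewrite lt_neqAle eq_sym vn0.
have r0 : (0 < 4 * t / v)%R by rewrite divr_gt0// mulr_gt0.
apply: (le_trans (chern _ r0)); rewrite lee_fin ler_expR.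
have -> : ((4 * t / v) ^+ 2 * v / 8 - 4 * t / v * t = - (2 * t ^+ 2 / v))%R.
  by field.
by [].
Qed.

Lemma subgaussian_tail (W : {RV P >-> R}) v t : (0 <= v)%R -> (0 < t)%R ->
  subgaussian W v ->
  P [set w | (t <= `|W w|)%R] <= (2 * exp_neg_div (2 * t ^+ 2) v)%:E.
Proof.
move=> v0 t0 sW.
pose N : {RV P >-> R} := HB.pack (\- W)%R (isMeasurableFun.Build _ _ _ _ _
  (measurable_funN (measurable_funPT W))).
have mge (V : {RV P >-> R}) : measurable [set w | (t <= V w)%R].
  exact: measurable_set_ge.
have -> : [set w | (t <= `|W w|)%R] =
    [set w | (t <= W w)%R] `|` [set w | (t <= N w)%R].
  apply/seteqP; split => w /=; rewrite lerNr.
    by rewrite ler_normr => /orP[->|]; [left|rewrite lerNr; right].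
  by rewrite ler_normr => -[->//|h]; rewrite [X in _ || X]lerNr h orbT.
apply: (le_trans (measureU2 _ (mge W) (mge N))).
rewrite mulrDl mul1r EFinD; apply: leeD; first exact: subgaussian_upper_tail.
apply: subgaussian_upper_tail => //; exact: subgaussianN.
Qed.

Lemma ae_bounded_Lfun1 (Z : T -> R) c : measurable_fun setT Z ->
  (forall w, 0 <= Z w)%R -> {ae P, forall w, (Z w <= c)%R} -> Z \in Lfun P 1.
Proof.
move=> mZ Z0 Zc; apply/Lfun1_integrable/integrableP; split.
  exact/measurable_EFinP.
apply: (@le_lt_trans _ _ (\int[P]_w `|c|%:E)).
  apply: ae_ge0_le_integral => //.
  - by apply: measurableT_comp => //; exact/measurable_EFinP.
  - apply: filterS Zc => w Zcw _ /=.
    by rewrite lee_fin ger0_norm// (le_trans Zcw)// ler_norm.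
by rewrite integral_cst//= probability_setT mule1 ltry.
Qed.

(** Hoeffding's lemma: by convexity the moment generating function is at most
    that of the Bernoulli variable on [{0, c}] with the same mean. *)
Lemma ae_bounded_subgaussian (Z : T -> R) (c : R) : measurable_fun setT Z ->
  (forall w, 0 <= Z w)%R -> (0 <= c)%R -> {ae P, forall w, (Z w <= c)%R} ->
  subgaussian (fun w => Z w - fine 'E_P[Z])%R (c ^+ 2).
Proof.
move=> mZ Z0 c0 Zc l.
set mu := fine _.
(* truncation turns the almost sure bound into a pointwise one *)
pose Y := (fun w => Num.min (Z w) c).
have mY : measurable_fun setT Y by exact: measurable_minr.
have Y0 w : (0 <= Y w)%R by rewrite le_min Z0.
have Yc w : (Y w <= c)%R by rewrite ge_min lexx orbT.
have YZ : {ae P, forall w, Z w = Y w}.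
  by apply: filterS Zc => w Zw; rewrite /Y min_l.
have Y1 : Y \in Lfun P 1.
  by apply: (ae_bounded_Lfun1 (c := c)) => //; exact: aeW.
have EY : 'E_P[Y] = mu%:E.
  rewrite -[LHS]fineK ?expectation_fin_num//; congr (fine _)%:E.
  rewrite unlock; apply: ge0_ae_eq_integral => //.
  - exact/measurable_EFinP.
  - exact/measurable_EFinP.
  - by move=> w _; rewrite lee_fin.
  - by move=> w _; rewrite lee_fin.
  - by apply: filterS YZ => w ->.
have mu0 : (0 <= mu)%R by rewrite -lee_fin -EY expectation_ge0.
have muc : (mu <= c)%R.
  rewrite -lee_fin -EY -(expectation_cst P c) expectation_le//; exact: aeW.
have me (X : T -> R) : measurable_fun setT X ->
    measurable_fun setT (fun w => (expR (l * (X w - mu)))%:E).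
  move=> mX; apply/measurable_EFinP; apply: measurableT_comp => //.
  by apply: measurable_funM => //; exact: measurable_funB.
rewrite (ge0_ae_eq_integral (g := fun w => (expR (l * (Y w - mu)))%:E)) => //;
  last first.
- by apply: filterS YZ => w -> _.
- exact: me.
- exact: me.
have [c00|cn0] := eqVneq c 0%R.
  have Y00 w : Y w = 0%R by apply/eqP; rewrite eq_le Y0 -c00 Yc.
  have -> : mu = 0%R by apply/eqP; rewrite eq_le mu0 -c00 muc.
  under eq_integral do rewrite Y00 subr0 mulr0 expR0.
  rewrite integral_cst//= probability_setT mule1 c00 expr0n/=.
  by rewrite mulr0 mul0r expR0.
have cp : (0 < c)%R by rewrite lt_neqAle eq_sym cn0.
(* the expectation of [expR (l * (Y - mu))] is at most that of its chord *)
pose e := expR (- (l * mu)).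
pose b := ((expR (l * c) - 1) / c)%R.
pose chord := (cst e \+ (e * b) \o* Y)%R.
have le_chord w : (expR (l * (Y w - mu)) <= chord w)%R.
  rewrite mulrBr expRD /chord/= -/e mulrC.
  have -> : (e + Y w * (e * b) = e * (1 - Y w / c + Y w / c * expR (l * c)))%R.
    by rewrite /b; field.
  by rewrite ler_pM2l ?expR_gt0// expR_le_chord// Y0 Yc.
apply: (@le_trans _ _ 'E_P[chord]).
  rewrite unlock; apply: ge0_le_integral => //.
  - exact: me.
  - apply/measurable_EFinP; apply: measurable_funD => //.
    exact: measurable_funM.
  - by move=> w _; rewrite lee_fin; exact: le_chord.
rewrite /chord expectationD ?Lfun_cst ?Lfun_scale//.
rewrite expectation_cst expectationZl// EY -EFinM -EFinD lee_fin.
have -> : (e + e * b * mu = e * (1 - mu / c + mu / c * expR (l * c)))%R.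
  by rewrite /b; field.
have p01 : (0 <= mu / c <= 1)%R.
  by rewrite divr_ge0//= ler_pdivrMr ?mul1r.
apply: (@le_trans _ _ (e * expR (mu / c * (l * c) + (l * c) ^+ 2 / 8))%R).
  by rewrite ler_pM2l ?expR_gt0// bernoulli_mgf_le.
rewrite /e -expRD ler_expR.
by have -> : (- (l * mu) + (mu / c * (l * c) + (l * c) ^+ 2 / 8) =
  l ^+ 2 * c ^+ 2 / 8)%R by field.
Qed.

End subgaussian.

(** * Sums over independent blocks *)

Section blocks.
Context {d : measure_display} {T : measurableType d} {R : realType}.
Variable P : probability T R.
Context {K : finType} (X : K -> {RV P >-> R}).

Lemma sigma_gen_sub (J J' : {set K}) : {subset J <= J'} ->
  <<s cylinders X J>> `<=` <<s cylinders X J'>>.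
Proof.
move=> JJ'; apply: sub_sigma_algebra2 => _ [A mA <-].
exists (fun k => if k \in J then A k else setT).
  by move=> k; case: ifP.
apply/seteqP; split => w wA k /= kJ.
  by have /= := wA k (JJ' _ kJ); rewrite kJ.
by case: ifPn => // kJ0; exact: wA.
Qed.

Lemma measurable_fun_sigma_gen_sub (J J' : {set K}) (U : T -> R) :
  {subset J <= J'} ->
  measurable_fun [set: sigma_gen X J] (U : sigma_gen X J -> R) ->
  measurable_fun [set: sigma_gen X J'] (U : sigma_gen X J' -> R).
Proof.
move=> JJ' mU _ A mA; rewrite setTI; apply: (sigma_gen_sub JJ').
by rewrite -[_ @^-1` _]setTI; exact: mU.
Qed.

Hypothesis indX : mutually_independent X.

Lemma independent2_sigma_gen (J1 J2 : {set K}) (U V : T -> R) :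
  {in J1, forall k, k \notin J2} ->
  measurable_fun [set: sigma_gen X J1] (U : sigma_gen X J1 -> R) ->
  measurable_fun [set: sigma_gen X J2] (V : sigma_gen X J2 -> R) ->
  independent2 P U V.
Proof.
move=> dJ mU mV A B mA mB; apply: (disjoint_sigma_independent indX dJ).
- by rewrite -[_ @^-1` _]setTI; exact: mU.
- by rewrite -[_ @^-1` _]setTI; exact: mV.
Qed.

(** The parameters [v] add up because the moment generating function of a sum
    of independent terms is a product. The partition of the family into
    independent blocks is given by the label [b]. *)
Lemma subgaussian_sum_blocks {I : finType} (b : K -> I) (W : I -> T -> R)
    (v : I -> R) :
  (forall s, measurable_fun [set: sigma_gen X [set k | b k == s]%SET]
    (W s : sigma_gen X [set k | b k == s]%SET -> R)) ->
  (forall s, subgaussian P (W s) (v s)) ->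
  subgaussian P (fun w => \sum_s W s w) (\sum_s v s).
Proof.
move=> mW sW.
elim: (index_enum I) (index_enum_uniq I) => [_ l|s r IH /= /andP[sr ur]].
  under eq_integral do rewrite big_nil mulr0 expR0.
  by rewrite integral_cst//= probability_setT mule1 big_nil mulr0 mul0r expR0.
pose J := [set k | b k \in r]%SET.
have mr : measurable_fun [set: sigma_gen X J]
    ((fun w => \sum_(t <- r) W t w) : sigma_gen X J -> R).
  have -> : (fun w => \sum_(t <- r) W t w) =
      (fun w => \sum_(t <- r) if t \in r then W t w else 0).
    by apply/funext => w; rewrite big_seq [RHS]big_seq; apply: eq_bigr => t ->.
  apply: measurable_sum => t; case: (boolP (t \in r)) => tr //.
  apply: measurable_fun_sigma_gen_sub (mW t) => k.
  by rewrite !inE => /eqP->.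
have ms := mW s.
pose Ui := isMeasurableFun.Build _ _ _ _ (W s) (sigma_gen_measurable_fun ms).
pose U : {RV P >-> R} := HB.pack (W s) Ui.
pose Vi := isMeasurableFun.Build _ _ _ _ (fun w => \sum_(t <- r) W t w)
  (sigma_gen_measurable_fun mr).
pose V : {RV P >-> R} := HB.pack (fun w => \sum_(t <- r) W t w) Vi.
rewrite big_cons.
have -> : (fun w => \sum_(t <- s :: r) W t w) = U \+ V.
  by apply/funext => w; rewrite big_cons.
apply: subgaussianD_independent; [|exact: sW|exact: IH].
apply: (independent2_sigma_gen _ ms mr) => k.
by rewrite !inE => /eqP->.
Qed.

End blocks.

(** * Unbiasedness of the empirical variance *)

Lemma measurable_emp_var {d} {T : measurableType d} {R : realType} m
    (X : 'I_m -> T -> R) : (forall j, measurable_fun setT (X j)) ->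
  measurable_fun setT (emp_var X).
Proof.
move=> mX; apply: measurable_funM => //; apply: measurable_sum => j.
apply: measurable_funX; apply: measurable_funB => //.
by apply: measurable_funM => //; exact: measurable_sum.
Qed.

Lemma measurable_emp_std_dev {d} {T : measurableType d} {R : realType} m
    (X : 'I_m -> T -> R) : (forall j, measurable_fun setT (X j)) ->
  measurable_fun setT (emp_std_dev X).
Proof.
move=> mX; apply: measurableT_comp; last exact: measurable_emp_var.
apply: continuous_measurable_fun; exact: sqrt_continuous.
Qed.

Section unbiased.
Local Open Scope ereal_scope.
Context {d : measure_display} {T : measurableType d} {R : realType}.
Variable P : probability T R.

Lemma expectation_bigsum {I : eqType} (r : seq I) (F : I -> T -> R) :
  (forall i, F i \in Lfun P 1) ->
  'E_P[(fun w => \sum_(i <- r) F i w)%R] = \sum_(i <- r) 'E_P[F i].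
Proof.
move=> F1.
have -> : (fun w => \sum_(i <- r) F i w)%R = (\sum_(i <- r) F i)%R.
  by apply/funext => w; rewrite fct_sumE.
rewrite -(big_map F xpredT idfun) expectation_sum ?big_map//.
by move=> f /mapP[i _ ->].
Qed.

Lemma Lfun1_bigsum {I : Type} (r : seq I) (F : I -> T -> R) :
  (forall i, F i \in Lfun P 1) -> (fun w => \sum_(i <- r) F i w)%R \in Lfun P 1.
Proof.
move=> F1.
have -> : (fun w => \sum_(i <- r) F i w)%R = (\sum_(i <- r) F i)%R.
  by apply/funext => w; rewrite fct_sumE.
by rewrite rpred_sum.
Qed.

(** At the common mean [c] of independent samples, the products with [i != j]
    on the right have expectation 0. *)
Lemma emp_var_centered m (X : 'I_m -> T -> R) (c : R) w : (0 < m)%N ->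
  (emp_var X w = (m%:R - 1)^-1 *
    (\sum_j (X j w - c) ^+ 2
     - m%:R^-1 * \sum_i \sum_j (X i w - c) * (X j w - c)))%R.
Proof.
move=> m0; rewrite /emp_var; congr (_ * _)%R.
have m0R : (m%:R != 0 :> R)%R by rewrite pnatr_eq0 -lt0n.
have -> : (\sum_i \sum_j (X i w - c) * (X j w - c) =
    (\sum_j (X j w - c)) ^+ 2)%R.
  by rewrite expr2 mulr_suml; apply: eq_bigr => i _; rewrite mulr_sumr.
set S := (\sum_j (X j w - c))%R.
have -> : emp_mean X w = (c + m%:R^-1 * S)%R.
  rewrite /emp_mean /S sumrB sumr_const card_ord mulrBr.
  by rewrite -[(c *+ m)%R]mulr_natl mulKf// addrC subrK.
under eq_bigr do rewrite opprD addrA sqrrB.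
rewrite !big_split/= sumr_const card_ord sumrN.
rewrite sumrMnl -mulr_suml -/S -mulr_natl.
by field.
Qed.

(** In the centred form of the empirical variance the off-diagonal products
    have expectation 0, so that the expectation is
    [(m - 1)^-1 * (m * s2 - m^-1 * (m * s2)) = s2]. *)
Lemma expectation_emp_var m (X : 'I_m -> {RV P >-> R}) (mu s2 : R) :
  (2 <= m)%N ->
  (forall i j, i != j -> independent2 P (X i) (X j)) ->
  (forall j, (X j : T -> R) \in Lfun P 1) ->
  (forall j, 'E_P[X j] = mu%:E) ->
  (forall j, (fun w => (X j w - mu) ^+ 2)%R \in Lfun P 1) ->
  (forall j, 'V_P[X j] = s2%:E) ->
  'E_P[emp_var X] = s2%:E.
Proof.
move=> m2 ind X1 EX X2 VX.
have cov i j : (fun w => (X i w - mu) * (X j w - mu))%R \in Lfun P 1 /\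
  'E_P[(fun w => (X i w - mu) * (X j w - mu))%R] =
    (if i == j then s2 else 0%R)%:E.
  case: eqVneq => [->|ij].
    split; first exact: X2.
    by rewrite -(VX j) /variance covariance.unlock EX.
  have XX1 := Lfun1_prod_independent (ind _ _ ij) (X1 i) (X1 j).
  split.
    have -> : (fun w => (X i w - mu) * (X j w - mu))%R =
      (X i \* X j \- mu \o* X j \- mu \o* X i \+ cst (mu * mu))%R.
      by apply/funext => w /=; ring.
    by rewrite rpredD ?Lfun_cst// rpredB ?Lfun_scale// rpredB ?Lfun_scale.
  have <- : covariance P (X i) (X j) = 0%R%:E.
    have EE : 'E_P[X i] * 'E_P[X j] = (mu * mu)%:E by rewrite !EX -EFinM.
    have EXX : 'E_P[X i \* X j] = (mu * mu)%:E.
      by rewrite -EE; exact: expectation_prod_independent (ind _ _ ij) _ _.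
    rewrite covarianceE// -[X in _ - X]/('E_P[X i] * 'E_P[X j]) EE.
    by rewrite -[X in X - _]/('E_P[X i \* X j]) EXX -EFinB subrr.
  by rewrite covariance.unlock !EX.
have m1 : (m%:R - 1 != 0 :> R)%R.
  by rewrite subr_eq0 pnatr_eq1; case: eqP m2 => // ->.
have m0 : (m%:R != 0 :> R)%R by rewrite pnatr_eq0 -lt0n (ltn_trans _ m2).
pose A w := (\sum_j (X j w - mu) ^+ 2)%R.
pose B w := (\sum_i \sum_j (X i w - mu) * (X j w - mu))%R.
have -> : emp_var X = ((m%:R - 1)^-1 \o* (A \- m%:R^-1 \o* B))%R.
  apply/funext => w.
  rewrite (emp_var_centered _ mu)//; last exact: ltn_trans m2.
  by rewrite /A /B /= mulrC [(_ * m%:R^-1)%R]mulrC.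
have A1 : A \in Lfun P 1 by exact: Lfun1_bigsum.
have B1i i : (fun w => \sum_j (X i w - mu) * (X j w - mu))%R \in Lfun P 1.
  by apply: Lfun1_bigsum => j; case: (cov i j).
have B1 : B \in Lfun P 1 by exact: Lfun1_bigsum.
rewrite expectationZl ?rpredB ?Lfun_scale//.
rewrite expectationB ?Lfun_scale// expectationZl//.
have -> : 'E_P[A] = (m%:R * s2)%:E.
  rewrite expectation_bigsum//.
  under eq_bigr => j _.
    have [_] := cov j j; rewrite eqxx => ->; over.
  by rewrite sumEFin sumr_const card_ord mulr_natl.
have -> : 'E_P[B] = (m%:R * s2)%:E.
  rewrite expectation_bigsum//.
  under eq_bigr => i _.
    rewrite expectation_bigsum; last by move=> j; case: (cov i j).
    under eq_bigr => j _ do rewrite (proj2 (cov i j)).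
    rewrite sumEFin -big_mkcond/= (eq_bigl (pred1 i)) ?big_pred1_eq; last first.
      by move=> j; rewrite eq_sym.
    over.
  by rewrite sumEFin sumr_const card_ord mulr_natl.
rewrite -[LHS]/((m%:R - 1)^-1 *
  (m%:R * s2 - m%:R^-1 * (m%:R * s2)))%R%:E; congr EFin.
by field; rewrite m0 m1.
Qed.

End unbiased.

(** * Transfer of integrability and expectations between laws *)

Section laws.
Local Open Scope ereal_scope.
Context {d : measure_display} {T : measurableType d} {R : realType}.
Variable P : probability T R.

Lemma same_distribution_integral (X X' : {RV P >-> R}) (f : R -> \bar R) :
  same_distribution X X' -> measurable_fun setT f -> (forall x, 0 <= f x) ->
  \int[P]_w f (X w) = \int[P]_w f (X' w).
Proof.
move=> XX' mf f0.
rewrite -[LHS](ge0_integral_distribution X mf f0).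
rewrite -[RHS](ge0_integral_distribution X' mf f0).
by apply: eq_measure_integral => A mA _; exact: XX'.
Qed.

Lemma same_distribution_Lfun1 (X X' : {RV P >-> R}) (f : R -> R) :
  same_distribution X X' -> measurable_fun setT f ->
  f \o X' \in Lfun P 1 -> f \o X \in Lfun P 1.
Proof.
move=> XX' mf /Lfun1_integrable/integrableP[_ i].
apply/Lfun1_integrable/integrableP.
split; first by apply/measurable_EFinP; exact: measurableT_comp.
rewrite (same_distribution_integral (f := fun x => `|(f x)%:E|) XX')//.
by apply: measurableT_comp => //; exact/measurable_EFinP.
Qed.

Lemma same_distribution_expectation (X X' : {RV P >-> R}) (f : R -> R) :
  same_distribution X X' -> measurable_fun setT f ->
  f \o X' \in Lfun P 1 -> 'E_P[f \o X] = 'E_P[f \o X'].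
Proof.
move=> XX' mf i'.
have /Lfun1_integrable i := same_distribution_Lfun1 XX' mf i'.
move/Lfun1_integrable : i' => i'.
have mEf : measurable_fun setT (EFin \o f) by exact/measurable_EFinP.
rewrite unlock -[LHS](integral_distribution (X := X) mEf i).
rewrite -[RHS](integral_distribution (X := X') mEf i').
by apply: eq_measure_integral => A mA _; exact: XX'.
Qed.

(** The conditional law is dominated by [(P E)^-1] times the unconditional
    one. *)
Lemma cond_distribution_Lfun1 (X Q : {RV P >-> R}) (E : set T) (f : R -> R) :
  measurable E -> 0 < P E ->
  has_cond_distribution X Q E -> measurable_fun setT f ->
  f \o Q \in Lfun P 1 -> f \o X \in Lfun P 1.
Proof.
move=> mE PE XQ mf /Lfun1_integrable/integrableP[_ i].
apply/Lfun1_integrable/integrableP.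
split; first by apply/measurable_EFinP; exact: measurableT_comp.
have mg : measurable_fun setT (fun x => `|(f x)%:E|).
  by apply: measurableT_comp => //; exact/measurable_EFinP.
have g0 x : 0 <= `|(f x)%:E| by [].
rewrite -(ge0_integral_distribution X mg g0).
have [e e0 PEe] : exists2 e : R, (0 < e)%R & P E = e%:E.
  have PEf : P E \is a fin_num by exact: fin_num_measure.
  by exists (fine (P E)); rewrite ?fineK// -lte_fin fineK.
have c0 : (0 <= e^-1)%R by rewrite invr_ge0 ltW.
pose nu := mscale (NngNum c0) (distribution P Q).
apply: (@le_lt_trans _ _ (\int[nu]_x `|(f x)%:E|)).
  apply: ge0_le_measure_integral => // A mA.
  apply: (@le_trans _ _ (P (Q @^-1` A `&` E) / P E)).
    by rewrite -(XQ _ mA).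
  rewrite /nu /mscale/= PEe inver gt_eqF// muleC.
  rewrite lee_wpmul2l// ?lee_fin// le_measure// ?inE.
  - by apply: measurableI => //; exact: measurable_preimage.
  - exact: measurable_preimage.
rewrite ge0_integral_mscale// ge0_integral_distribution//.
by apply: lte_mul_pinfty => //; rewrite lee_fin.
Qed.

End laws.

(** * The two variance estimators of a stratified sample *)

Section stratified_sample.
Local Open Scope ereal_scope.
Context {d : measure_display} {T : measurableType d} {R : realType}.
Variable P : probability T R.
Context {I : finType} (QS : I -> {RV P >-> R}) (m : I -> nat)
  (X : forall s : I, 'I_(m s) -> {RV P >-> R}).
Hypotheses (Q1 : forall s, (QS s : T -> R) \in Lfun P 1)
  (Q2 : forall s, (fun w => QS s w ^+ 2)%R \in Lfun P 1)
  (m2 : forall s, (2 <= m s)%N)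
  (lawX : forall s (j : 'I_(m s)), same_distribution (X j) (QS s))
  (indX : mutually_independent
     (fun k : {s : I & 'I_(m s)} => X (tagged k))).

Let samples (k : {s : I & 'I_(m s)}) := X (tagged k).
Let block (s : I) : {set {s : I & 'I_(m s)}} := [set k | tag k == s]%SET.
Let sigma s := std_dev P (QS s).
Let sigma_hat s := emp_std_dev (@X s).

Let measurable_block s (j : 'I_(m s)) :
  measurable_fun [set: sigma_gen samples (block s)]
    (X j : sigma_gen samples (block s) -> R).
Proof.
have h : Tagged (fun s => 'I_(m s)) j \in block s by rewrite inE.
exact: (measurable_sigma_gen (X := samples) h).
Qed.

Let measurable_sigma_hat_block s :
  measurable_fun [set: sigma_gen samples (block s)]
    (sigma_hat s : sigma_gen samples (block s) -> R).
Proof. by apply: measurable_emp_std_dev => j; exact: measurable_block. Qed.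

Let measurable_sigma_hat s : measurable_fun setT (sigma_hat s).
Proof. exact: (sigma_gen_measurable_fun (@measurable_sigma_hat_block s)). Qed.

Let blocks_disjoint s t : s != t -> {in block s, forall k, k \notin block t}.
Proof. by move=> st k; rewrite !inE => /eqP ->. Qed.

Let emp_var_ge0 s w : (0 <= emp_var (@X s) w)%R.
Proof.
apply: mulr_ge0; last by apply: sumr_ge0 => j _; exact: sqr_ge0.
by rewrite invr_ge0 subr_ge0 ler1n (ltn_trans _ (m2 s)).
Qed.

Let sigma_hat_sqr s : (fun w => sigma_hat s w ^+ 2)%R = emp_var (@X s).
Proof. by apply/funext => w; rewrite sqr_sqrtr. Qed.

Let Q_centered_sqr s (c : R) : (fun w => (QS s w - c) ^+ 2)%R \in Lfun P 1.
Proof.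
have -> : (fun w => (QS s w - c) ^+ 2)%R =
    ((fun w => QS s w ^+ 2) \- (c * 2) \o* QS s \+ cst (c ^+ 2))%R.
  by apply/funext => w /=; ring.
by rewrite rpredD ?Lfun_cst// rpredB ?Lfun_scale.
Qed.

Let sigma_sqr s : 'V_P[QS s] = (sigma s ^+ 2)%:E.
Proof.
have Vf : 'V_P[QS s] \is a fin_num.
  rewrite /variance covariance.unlock expectation_fin_num//.
  exact: Q_centered_sqr.
have h : (0 <= fine 'V_P[QS s])%R by apply: fine_ge0; exact: variance_ge0.
by rewrite /sigma /std_dev sqr_sqrtr // fineK.
Qed.

Let expectation_X s (j : 'I_(m s)) : 'E_P[X j] = 'E_P[QS s].
Proof.
exact: (same_distribution_expectation (lawX j) (@measurable_id _ _ _) (Q1 s)).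
Qed.

Lemma expectation_sigma_hat_sqr s :
  'E_P[(fun w => sigma_hat s w ^+ 2)%R] = (sigma s ^+ 2)%:E.
Proof.
rewrite sigma_hat_sqr.
pose mu := fine 'E_P[QS s].
have mf : measurable_fun setT (fun x : R => (x - mu) ^+ 2)%R.
  by apply: measurable_funX; exact: measurable_funB.
apply: (@expectation_emp_var _ _ _ _ _ _ mu) => //.
- move=> i j ij.
  pose k (i' : 'I_(m s)) := Tagged (fun s => 'I_(m s)) i'.
  have kk i' : k i' \in [set k i']%SET by rewrite inE.
  apply: (independent2_sigma_gen indX _
    (measurable_sigma_gen (X := samples) (kk i))
    (measurable_sigma_gen (X := samples) (kk j))) => x.
  by rewrite !inE => /eqP->; rewrite eq_Tagged.
- move=> j.
  exact: (same_distribution_Lfun1 (lawX j) (@measurable_id _ _ _) (Q1 s)).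
- by move=> j; rewrite expectation_X fineK// expectation_fin_num.
- move=> j; apply: (same_distribution_Lfun1 (lawX j) mf).
  exact: Q_centered_sqr.
- move=> j; rewrite -sigma_sqr /variance !covariance.unlock expectation_X.
  apply: (same_distribution_expectation (lawX j) mf).
  exact: Q_centered_sqr.
Qed.

Variable M : I -> R.
Hypotheses (M0 : forall s, (0 <= M s)%R)
  (hM : forall s, {ae P, forall w, (sigma_hat s w <= M s)%R}).
Variable p : I -> R.
Hypothesis p0 : forall s, (0 <= p s)%R.

Let sigma_hat_Lfun1 s : sigma_hat s \in Lfun P 1.
Proof. apply: ae_bounded_Lfun1 (hM s) => // w; exact: sqrtr_ge0. Qed.

Let sigma_hat_sqr_Lfun1 s : (fun w => sigma_hat s w ^+ 2)%R \in Lfun P 1.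
Proof.
apply: (ae_bounded_Lfun1 (c := (M s ^+ 2)%R)).
- exact: measurable_funX.
- by move=> w; exact: sqr_ge0.
- by apply: filterS (hM s) => w h; rewrite lerXn2r ?nnegrE// sqrtr_ge0.
Qed.

Let sigma_hat_rv s : {RV P >-> R} :=
  HB.pack (sigma_hat s)
    (isMeasurableFun.Build _ _ _ _ _ (measurable_sigma_hat s)).

Let sigma_hat_independent s t :
  s != t -> independent2 P (sigma_hat s) (sigma_hat t).
Proof.
move=> st; apply: (independent2_sigma_gen indX (blocks_disjoint st));
  exact: measurable_sigma_hat_block.
Qed.

(** [N] times the deviation is a sum, over independent strata, of centred
    variables with values in intervals of length [p s * M s ^+ 2]. *)
Lemma var_prop_tail N (theta : R) : (0 < theta)%R ->
  P [set w | (theta <=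
      `|var_prop N p (sigma_hat ^~ w) - var_prop N p sigma|)%R]
  <= (2 * exp_neg_div (2 * theta ^+ 2 * N%:R ^+ 2)
        (\sum_s p s ^+ 2 * M s ^+ 4))%:E.
Proof.
move=> th0.
pose W s w := (p s * sigma_hat s w ^+ 2 - p s * sigma s ^+ 2)%R.
have sW s : subgaussian P (W s) (p s ^+ 2 * M s ^+ 4).
  have -> : (p s ^+ 2 * M s ^+ 4 = (p s * M s ^+ 2) ^+ 2)%R by ring.
  pose Z w := (p s * sigma_hat s w ^+ 2)%R.
  have -> : W s = (fun w => Z w - fine 'E_P[Z])%R.
    have -> : Z = (p s \o* (fun w => sigma_hat s w ^+ 2))%R.
      by apply/funext => w; rewrite /= mulrC.
    rewrite expectationZl// expectation_sigma_hat_sqr -EFinM/=.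
    by apply/funext => w; rewrite /W/= [(_ * p s)%R]mulrC.
  apply: ae_bounded_subgaussian.
  - by apply: measurable_funM => //; exact: measurable_funX.
  - by move=> w; rewrite mulr_ge0// sqr_ge0.
  - by rewrite mulr_ge0// sqr_ge0.
  - apply: filterS (hM s) => w h.
    by rewrite ler_wpM2l// lerXn2r ?nnegrE// sqrtr_ge0.
have mWb s : measurable_fun [set: sigma_gen samples (block s)]
    (W s : sigma_gen samples (block s) -> R).
  apply: measurable_funB => //; apply: measurable_funM => //.
  by apply: measurable_funX; exact: measurable_sigma_hat_block.
have sS := subgaussian_sum_blocks indX mWb sW.
have mS : measurable_fun setT (fun w => \sum_s W s w)%R.
  by apply: measurable_sum => s; exact: (sigma_gen_measurable_fun (mWb s)).
pose S : {RV P >-> R} := HB.pack (fun w => \sum_s W s w)%R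
  (isMeasurableFun.Build _ _ _ _ _ mS).
have v0 : (0 <= \sum_s p s ^+ 2 * M s ^+ 4)%R.
  by apply: sumr_ge0 => s _; rewrite mulr_ge0 ?exprn_ge0.
have devE w : (var_prop N p (sigma_hat ^~ w) - var_prop N p sigma =
    N%:R^-1 * S w)%R.
  by rewrite /var_prop -mulrBr -sumrB.
(* with no sample both estimators are 0, and the event is empty *)
have [N0|N0] := posnP N.
  rewrite [X in P X](_ : _ = set0) ?measure0; last first.
    apply/seteqP; split => w //=; rewrite devE N0 invr0 mul0r normr0.
    by rewrite leNgt th0.
  rewrite lee_fin mulr_ge0// /exp_neg_div; case: ifP => // _; exact: expR_ge0.
have NR : (0 < N%:R :> R)%R by rewrite ltr0n.
have Ni0 : (0 < N%:R^-1 :> R)%R by rewrite invr_gt0.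
have t0 : (0 < theta * N%:R)%R by rewrite mulr_gt0.
have tail := subgaussian_tail (W := S) v0 t0 sS.
rewrite [X in P X](_ : _ = [set w | (theta * N%:R <= `|S w|)%R]); last first.
  apply/seteqP; split => w /=; rewrite devE normrM (gtr0_norm Ni0);
    by rewrite ler_pdivlMl// mulrC.
by apply: (le_trans tail); rewrite exprMn mulrA.
Qed.

(** The diagonal terms of the expanded square are unbiased. Off the diagonal,
    independence gives the product of the means [sigma s + b s] and
    [sigma t + b t], whose excess over [sigma s * sigma t] is the summand of
    [bias_opt]. *)
Lemma expectation_sqr_sum_sigma_hat
    (b := fun s => (fine 'E_P[sigma_hat s] - sigma s)%R) :
  'E_P[(fun w => (\sum_s p s * sigma_hat s w) ^+ 2)%R] =
  ((\sum_s p s * sigma s) ^+ 2 + bias_opt p sigma b)%:E.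
Proof.
pose cross s t :=
  (if t != s then b s * b t + b s * sigma t + b t * sigma s else 0)%R.
have prodE s t : (fun w => sigma_hat s w * sigma_hat t w)%R \in Lfun P 1 /\
   'E_P[(fun w => sigma_hat s w * sigma_hat t w)%R] =
     (sigma s * sigma t + cross s t)%:E.
  rewrite /cross; case: eqVneq => [->|ts].
    split; first exact: sigma_hat_sqr_Lfun1.
    by rewrite addr0; exact: expectation_sigma_hat_sqr.
  have st : s != t by rewrite eq_sym.
  split.
    exact: (@Lfun1_prod_independent _ _ _ P (sigma_hat_rv s) (sigma_hat_rv t)
      (sigma_hat_independent st) (sigma_hat_Lfun1 s) (sigma_hat_Lfun1 t)).
  transitivity ('E_P[sigma_hat s] * 'E_P[sigma_hat t]).
    exact: (@expectation_prod_independent _ _ _ P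
      (sigma_hat_rv s) (sigma_hat_rv t)
      (sigma_hat_independent st) (sigma_hat_Lfun1 s) (sigma_hat_Lfun1 t)).
  rewrite -[X in X * _]fineK ?expectation_fin_num//.
  rewrite -[X in _ * X]fineK ?expectation_fin_num// -EFinM; congr EFin.
  by rewrite /b /=; ring.
pose F s t w := (p s * p t * (sigma_hat s w * sigma_hat t w))%R.
have F1 s t : F s t \in Lfun P 1 /\ 'E_P[F s t] =
    (p s * p t * (sigma s * sigma t + cross s t))%:E.
  have [L1 L2] := prodE s t.
  have -> : F s t =
      ((p s * p t) \o* (fun w => sigma_hat s w * sigma_hat t w))%R.
    by apply/funext => w; rewrite /F/= mulrC.
  by rewrite Lfun_scale// expectationZl// L2.
have -> : (fun w => (\sum_s p s * sigma_hat s w) ^+ 2)%R =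
    (fun w => \sum_s \sum_t F s t w)%R.
  apply/funext => w; rewrite expr2 mulr_suml; apply: eq_bigr => s _.
  by rewrite mulr_sumr; apply: eq_bigr => t _; rewrite /F; ring.
rewrite expectation_bigsum; last first.
  by move=> s; apply: Lfun1_bigsum => t; case: (F1 s t).
under eq_bigr => s _.
  rewrite expectation_bigsum; last by move=> t; case: (F1 s t).
  under eq_bigr => t _ do rewrite (proj2 (F1 s t)).
  rewrite sumEFin.
  over.
rewrite sumEFin; congr EFin.
rewrite expr2 mulr_suml /bias_opt -big_split/=; apply: eq_bigr => s _.
rewrite mulr_sumr [X in (_ + X)%R]big_mkcond -big_split/=.
by apply: eq_bigr => t _; rewrite /cross; case: ifP => _; ring.
Qed.

(** Hoeffding's lemma applies to the squared sum as one single bounded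
    variable; its bias [B] is moved into the threshold. *)
Lemma var_opt_tail N (b := fun s => (fine 'E_P[sigma_hat s] - sigma s)%R)
    (B := bias_opt p sigma b) (theta : R) : (`|B| / N%:R < theta)%R ->
  P [set w | (theta <=
      `|var_opt N p (sigma_hat ^~ w) - var_opt N p sigma|)%R]
  <= (2 * exp_neg_div (2 * (`|B| - theta * N%:R) ^+ 2)
        ((\sum_s p s * M s) ^+ 4))%:E.
Proof.
move=> thB.
pose Z w := ((\sum_s p s * sigma_hat s w) ^+ 2)%R.
pose c := ((\sum_s p s * M s) ^+ 2)%R.
have mZ : measurable_fun setT Z.
  by apply: measurable_funX; apply: measurable_sum => s; exact: measurable_funM.
have Zc : {ae P, forall w, (Z w <= c)%R}.
  have : {ae P, forall w s, (sigma_hat s w <= M s)%R}.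
    exact: (@filter_forall _ _ _ _ (ae_filter_ringOfSetsType P) hM).
  apply: filterS => w h; rewrite lerXn2r ?nnegrE//.
  - by apply: sumr_ge0 => s _; rewrite mulr_ge0// sqrtr_ge0.
  - by apply: sumr_ge0 => s _; rewrite mulr_ge0.
  - by apply: ler_sum => s _; rewrite ler_wpM2l.
have sZ := ae_bounded_subgaussian mZ (fun w => sqr_ge0 _) (sqr_ge0 _) Zc.
have mW : measurable_fun setT (fun w => Z w - fine 'E_P[Z])%R.
  exact: measurable_funB.
pose W : {RV P >-> R} := HB.pack (fun w => Z w - fine 'E_P[Z])%R
  (isMeasurableFun.Build _ _ _ _ _ mW).
have devE w : (var_opt N p (sigma_hat ^~ w) - var_opt N p sigma =
    N%:R^-1 * (W w + B))%R.
  rewrite /var_opt -mulrBr /=; congr (_ * _)%R.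
  by rewrite expectation_sqr_sum_sigma_hat/= /Z -/b -/B; ring.
have [N0|N0] := posnP N.
  move: thB; rewrite N0 invr0 mulr0 => th0.
  rewrite [X in P X](_ : _ = set0) ?measure0; last first.
    apply/seteqP; split => w //=; rewrite -[0%N]N0 devE N0 invr0 mul0r normr0.
    by rewrite leNgt th0.
  rewrite lee_fin mulr_ge0// /exp_neg_div; case: ifP => // _; exact: expR_ge0.
have NR : (0 < N%:R :> R)%R by rewrite ltr0n.
have Ni0 : (0 < N%:R^-1 :> R)%R by rewrite invr_gt0.
have t0 : (0 < theta * N%:R - `|B|)%R by rewrite subr_gt0 -ltr_pdivrMr.
have c0 : (0 <= c ^+ 2)%R by exact: sqr_ge0.
have := subgaussian_tail c0 t0 (W := W) sZ.
rewrite -exprM -sqrrN opprB; apply: le_trans.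
rewrite le_measure// ?inE.
- apply: measurable_set_ge; apply: measurableT_comp => //.
  under eq_fun do rewrite devE.
  by apply: measurable_funM => //; exact: measurable_funD.
- by apply: measurable_set_ge; exact: measurableT_comp.
move=> w /=; rewrite devE normrM (gtr0_norm Ni0).
rewrite ler_pdivlMl// mulrC lerBlDr => /le_trans; apply.
exact: ler_normD.
Qed.

End stratified_sample.

Theorem lemma1 (R : realType) (d : measure_display) (T : measurableType d)
  (P : probability T R) (n : nat)
  (Y : {RV P >-> n.-tuple R}) (hY : uniform_on_cube Y)
  (f : n.-tuple R -> R) (mf : measurable_fun [set: n.-tuple R] f)
  (hQ : (f \o Y) \in Lfun P 2%:E)
  (I : finType) (S : I -> set (n.-tuple R)) (hS : is_stratification S)
  (hp : forall s, (0 < P (Y @^-1` S s))%E)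
  (QS : I -> {RV P >-> R})
  (hQS : forall s, has_cond_distribution (QS s) (f \o Y) (Y @^-1` S s))
  (m : I -> nat) (hm : forall s, (2 <= m s)%N)
  (X : forall s : I, 'I_(m s) -> {RV P >-> R})
  (hX : forall s (j : 'I_(m s)), same_distribution (X s j) (QS s))
  (hindep : mutually_independent
     (fun k : {s : I & 'I_(m s)} => X (tag k) (tagged k)))
  (M : I -> R) (hM0 : forall s, 0 <= M s)
  (hM : forall s, {ae P, forall w, emp_std_dev (X s) w <= M s}) :
  let N := (\sum_s m s)%N in
  let p := fun s => fine (P (Y @^-1` S s)) in
  let sigma := fun s => std_dev P (QS s) in
  let sigma_hat := fun s => emp_std_dev (X s) in
  (proportional_allocation N p m ->
   forall theta : R, 0 < theta ->
   (P [set w | (theta <=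
         `|var_prop N p (fun s => sigma_hat s w) - var_prop N p sigma|)%R ]
    <= (2 * exp_neg_div (2 * theta ^+ 2 * N%:R ^+ 2)
              (\sum_s p s ^+ 2 * M s ^+ 4))%:E)%E)
  /\
  (optimal_allocation N p sigma m ->
   let b := fun s => fine 'E_P[sigma_hat s] - sigma s in
   let B := bias_opt p sigma b in
   forall theta : R, `|B| / N%:R < theta ->
   (P [set w | (theta <=
         `|var_opt N p (fun s => sigma_hat s w) - var_opt N p sigma|)%R ]
    <= (2 * exp_neg_div (2 * (`|B| - theta * N%:R) ^+ 2)
              ((\sum_s p s * M s) ^+ 4))%:E)%E).
Proof.
move=> N p sigma sigma_hat.
have mQ : measurable_fun setT (f \o Y) by exact: measurableT_comp.
pose Q : {RV P >-> R} := HB.pack (f \o Y) (isMeasurableFun.Build _ _ _ _ _ mQ).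
have mE s : measurable (Y @^-1` S s).
  rewrite -[_ @^-1` _]setTI; apply: (measurable_funPT Y) => //.
  by case: hS.
have QS1 s : (QS s : T -> R) \in Lfun P 1.
  apply: (cond_distribution_Lfun1 (Q := Q) (mE s) (hp s) (hQS s)
    (@measurable_id _ _ _)).
  by apply: Lfun_subset12 hQ; exact: fin_num_measure.
have QS2 s : (fun w => QS s w ^+ 2) \in Lfun P 1.
  apply: (cond_distribution_Lfun1 (Q := Q) (f := fun x => x ^+ 2)
    (mE s) (hp s) (hQS s)) => //.
  by apply/Lfun1_integrable; exact: Lfun2_integrable_sqr.
have p0 s : 0 <= p s by rewrite fine_ge0.
split=> [_ theta theta0|_ b B theta thetaB].
  exact: (var_prop_tail QS1 QS2).
exact: (var_opt_tail QS1 QS2).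
Qed.
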